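(* Let $X$ be a separable Banach space and suppose there is a constant $K<\infty$ such that every Banach space isomorphic to $X$ is $K$-elastic. Then $X$ is finite dimensional.
   Context: A Banach space $Y$ $K$-embeds into a Banach space $X$ if there is a linear map $T:Y\to X$ with $\|y\|\le\|Ty\|\le K\|y\|$ for all $y\in Y$. A Banach space $X$ is $K$-elastic if every Banach space $Y$ which is isomorphic to a subspace of $X$ $K$-embeds into $X$. Scalars are real. *)

(* Defs.v *)
From HB Require Import structures.
From mathcomp Require Import all_boot all_order all_algebra.
From mathcomp Require Import all_classical all_reals all_analysis.
Set Implicit Arguments. Unset Strict Implicit. Unset Printing Implicit Defensive.
Import Order.TTheory GRing.Theory Num.Theory.
Import numFieldNormedType.Exports.
Local Open Scope classical_set_scope.
Local Open Scope ring_scope.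

Definition is_linear (R : realType) (Y X : normedModType R) (T : Y -> X) :=
  forall (a : R) (u v : Y), T (a *: u + v) = a *: T u + T v.

Definition K_embeds (R : realType) (K : R) (Y X : normedModType R) :=
  exists T : Y -> X, is_linear T /\
    forall y : Y, `|y| <= `|T y| /\ `|T y| <= K * `|y|.

Definition iso_embeds (R : realType) (Y X : normedModType R) :=
  exists (T : Y -> X) (c C : R), is_linear T /\ 0 < c /\
    forall y : Y, c * `|y| <= `|T y| /\ `|T y| <= C * `|y|.

Definition isomorphic (R : realType) (Y X : normedModType R) :=
  exists (T : Y -> X) (c C : R), is_linear T /\ 0 < c /\ set_surj setT setT T /\
    forall y : Y, c * `|y| <= `|T y| /\ `|T y| <= C * `|y|.

Definition K_elastic (R : realType) (K : R) (X : completeNormedModType R) :=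
  forall Y : completeNormedModType R, iso_embeds Y X -> K_embeds K Y X.

Definition separable (T : topologicalType) :=
  exists D : set T, countable D /\ dense D.

Definition finite_dimensional (R : realType) (X : normedModType R) :=
  exists (n : nat) (e : 'I_n -> X),
    forall x : X, exists c : 'I_n -> R, x = \sum_(i < n) c i *: e i.

(* Main.v *)
Require Import Defs.
From HB Require Import structures.
From mathcomp Require Import all_boot all_order all_algebra.
From mathcomp Require Import all_classical all_reals all_analysis.
From mathcomp Require Import ring lra.
Set Implicit Arguments. Unset Strict Implicit. Unset Printing Implicit Defensive.
Import Order.TTheory GRing.Theory Num.Theory.
Import numFieldNormedType.Exports.
Local Open Scope classical_set_scope.
Local Open Scope ring_scope.

(** Two equivalent norms on [X] are built so that the first does not
    [K]-embed into the second. Fix [n] large compared with [K].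

    The first norm lives on a tree of height [n]: an almost biorthogonal system
    [(e s, f s)] is indexed by finite sequences of naturals, and the norm is the
    supremum, over branches of length at most [n], of the absolute value of the
    sum of the [f s] along the branch (plus a small multiple of the original
    norm). For a branch [s_1, s_2, ...] with siblings [t_1, t_2, ...] put
    [u_i = e s_i - e t_i]. The sum of [u_1, ..., u_n] has norm about [n], while
    their alternating sum has norm at most 4.

    The second norm is, for a sequence of finite-range maps [P m] of the dual
    ball into itself with [P m phi x -> phi x] uniformly in [phi], the supremum
    over [phi] and over partitions with at most [n + 1] points of the variation
    of [m |-> P m phi x]. For almost disjoint blocks with respect to [P], this
    norm is insensitive, up to a factor 2, to the signs of the blocks.

    If [S] is bounded, siblings in the tree can be chosen by pigeonhole so that
    the [S u_i] are almost disjoint blocks. So the sum and the alternating sum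
    of the [S u_i] have comparable norms, and [S] cannot be a [K]-embedding. *)

(** * Equivalent norms *)

Record equivalent_norm (R : realType) (X : normedModType R) := EquivalentNorm {
  enorm :> X -> R;
  enormD : forall x y, enorm (x + y) <= enorm x + enorm y;
  enormZ : forall (a : R) x, enorm (a *: x) = `|a| * enorm x;
  elow : R;
  elow_gt0 : 0 < elow;
  enorm_ge : forall x, elow * `|x| <= enorm x;
  eup : R;
  enorm_le : forall x, enorm x <= eup * `|x|
}.

Lemma enorm_eq0 (R : realType) (X : normedModType R) (N : equivalent_norm X) x :
  N x = 0 -> x = 0.
Proof.
move=> Nx; apply/eqP; rewrite -normr_le0 -(pmulr_rle0 _ (elow_gt0 N)).
by rewrite -Nx enorm_ge.
Qed.

(** An alias of the carrier [X], so that a second norm can be declared on it without clashing with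
    the given one. *)
Definition renormed (R : realType) (X : completeNormedModType R)
  (N : equivalent_norm X) : Type := X.

Section RenormedInstances.
Context (R : realType) (X : completeNormedModType R) (N : equivalent_norm X).

HB.instance Definition _ := GRing.Lmodule.copy (renormed N) X.
HB.instance Definition _ := @Lmodule_isNormed.Build R (renormed N)
  (enorm N) (enormD N) (@enormZ _ _ N) (@enorm_eq0 _ _ N).

Lemma renormed_complete (F : set_system (renormed N)) :
  ProperFilter F -> cauchy F -> cvg F.
Proof.
move=> FF /cauchy_ballP cF.
have cF' : cauchy (F : set_system X).
  apply/cauchy_ballP => e e0.
  have ce0 : 0 < elow N * e by rewrite mulr_gt0 ?elow_gt0.
  apply: filterS (cF _ ce0) => -[x y] /=.
  rewrite -!ball_normE /= => xy.
  rewrite -(ltr_pM2l (elow_gt0 N)).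
  exact: le_lt_trans (enorm_ge _ _) xy.
have /cvg_ex[/= l Fl] : cvg (F : set_system X) by exact: cauchy_cvg.
apply/cvg_ex; exists (l : renormed N).
apply/cvgrPdist_lt => e e0.
(* [eup N] carries no sign condition, so [|eup N| + 1] is taken as a positive upper constant. *)
have C0 : 0 < `|eup N| + 1 by rewrite ltr_wpDl.
move/cvgrPdist_lt : Fl => /(_ (e / (`|eup N| + 1))) /(_ (divr_gt0 e0 C0)).
apply: filterS => x; rewrite ltr_pdivlMr// => xe.
apply: le_lt_trans xe; apply: le_trans (enorm_le _ _) _.
rewrite mulrC ler_wpM2l//.
by apply: le_trans (ler_norm _) _; rewrite lerDl.
Qed.

HB.instance Definition _ :=
  Uniform_isComplete.Build (renormed N) renormed_complete.
End RenormedInstances.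

(** Both renormings are suprema of seminorms. The lower bound allows an error [e] because a single
    seminorm of the variation norm recovers [|x|] only approximately. *)
Lemma equivalent_norm_sup (R : realType) (X : normedModType R)
    (Q : set (X -> R)) (c C : R) :
  0 < c ->
  (forall q, Q q -> forall x y, q (x + y) <= q x + q y) ->
  (forall q, Q q -> forall (a : R) x, q (a *: x) = `|a| * q x) ->
  (forall q, Q q -> forall x, q x <= C * `|x|) ->
  (forall x e, 0 < e -> exists2 q, Q q & c * `|x| - e <= q x) ->
  exists N : equivalent_norm X,
    (forall q x, Q q -> q x <= N x) /\
    (forall x B, (forall q, Q q -> q x <= B) -> N x <= B).
Proof.
move=> c0 QD QZ QC Qc; pose N x := sup [set q x | q in Q].
have Qub x : has_ubound [set q x | q in Q].
  by exists (C * `|x|) => _ [q Qq <-]; exact: QC.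
have Q0 x : [set q x | q in Q] !=set0.
  by have [q Qq _] := Qc x 1 ltr01; exists (q x), q.
have leN q x : Q q -> q x <= N x by move=> Qq; apply: ub_le_sup => //; exists q.
have Nle x B : (forall q, Q q -> q x <= B) -> N x <= B.
  by move=> qB; apply: ge_sup => // _ [q Qq <-]; exact: qB.
have ND x y : N (x + y) <= N x + N y.
  by apply: Nle => q Qq; apply: le_trans (QD _ Qq _ _) _; rewrite lerD ?leN.
have NZle (a : R) x : N (a *: x) <= `|a| * N x.
  by apply: Nle => q Qq; rewrite QZ// ler_wpM2l ?leN.
have NZ (a : R) x : N (a *: x) = `|a| * N x.
  have [->|a0] := eqVneq a 0.
    rewrite scale0r normr0 mul0r; apply/eqP; rewrite eq_le; apply/andP; split.
      by apply: Nle => q Qq; rewrite -(scale0r 0) QZ// normr0 mul0r.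
    have [q Qq _] := Qc x 1 ltr01.
    by apply: le_trans (leN q _ Qq); rewrite -(scale0r 0) QZ// normr0 mul0r.
  apply/eqP; rewrite eq_le NZle/= -ler_pdivlMl ?normr_gt0//.
  by rewrite -normfV -{1}(scalerK a0 x) NZle.
have Nge x : c * `|x| <= N x.
  apply/ler_addgt0Pr => e e0; have [q Qq qe] := Qc x e e0.
  by rewrite -lerBlDr (le_trans qe)// leN.
have NC x : N x <= C * `|x| by apply: Nle => q Qq; exact: QC.
by exists (EquivalentNorm ND NZ c0 Nge NC).
Qed.

(** * Norming functionals *)

Definition sublinear (R : realType) (X : lmodType R) (p : X -> R) :=
  (forall x y, p (x + y) <= p x + p y) /\
  (forall (t : R) x, 0 <= t -> p (t *: x) = t * p x).

Section Sublinear.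
Context (R : realType) (X : lmodType R).
Implicit Types (p : X -> R) (x y : X).

Lemma sublinear0 p : sublinear p -> p 0 = 0.
Proof. by case=> _ /(_ 0 0 (lexx 0)); rewrite scale0r mul0r. Qed.

Lemma sublinear_ge p x : sublinear p -> - p (- x) <= p x.
Proof.
move=> sp; rewrite lerNl -subr_ge0 opprK addrC.
by rewrite (le_trans _ (sp.1 _ _))// subrr sublinear0.
Qed.

(** Serves twice: for the shifts of one functional and for a chain in Zorn's lemma. The bound [b]
    keeps the infimum finite. *)
Lemma sublinear_inf (Q : set (X -> R)) (b : X -> R) :
  Q !=set0 -> (forall q x, Q q -> b x <= q x) ->
  (forall q1 q2 x y, Q q1 -> Q q2 ->
    exists2 q, Q q & q (x + y) <= q1 x + q2 y) ->
  (forall q (t : R) x, Q q -> 0 < t -> exists2 q', Q q' & q' (t *: x) <= t * q x) ->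
  sublinear (fun x => inf [set q x | q in Q]).
Proof.
move=> [q0 Qq0] Qb QD QZ; pose I x := inf [set q x | q in Q]; rewrite -/(sublinear I).
have Ile q x : Q q -> I x <= q x.
  move=> Qq; apply: ge_inf; last by exists q.
  by exists (b x) => _ [q' Qq' <-]; exact: Qb.
have le_inf_Q x B : (forall q, Q q -> B <= q x) -> B <= I x.
  move=> qB; apply: lb_le_inf; first by exists (q0 x), q0.
  by move=> _ [q Qq <-]; exact: qB.
have IZ (t : R) x : 0 < t -> I (t *: x) <= t * I x.
  move=> t0; rewrite -ler_pdivrMl//; apply: le_inf_Q => q Qq.
  rewrite ler_pdivrMl//; have [q' Qq' qq'] := QZ q t x Qq t0.
  exact: le_trans (Ile _ _ Qq') qq'.
have IZE (t : R) x : 0 < t -> I (t *: x) = t * I x.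
  move=> t0; apply/eqP; rewrite eq_le IZ//= -ler_pdivlMl//.
  by rewrite -{1}(scalerK (lt0r_neq0 t0) x) IZ// invr_gt0.
split=> [x y|t x].
  rewrite -lerBlDr; apply: (le_inf_Q) => q1 Qq1; rewrite lerBlDr -lerBlDl.
  apply: (le_inf_Q) => q2 Qq2; rewrite lerBlDl.
  by have [q Qq] := QD q1 q2 x y Qq1 Qq2; apply: le_trans; exact: Ile.
rewrite le_eqVlt => /predU1P[<-|]; last exact: IZE.
rewrite scale0r mul0r; have := IZE 2 0 (ltr0n _ _).
by rewrite scaler0 => I2; lra.
Qed.

(** Take the infimum over [t >= 0] of [p (x + t *: y) - t * p y]; [t = 0] and [t = 1] give the two
    bounds. *)
Lemma sublinear_shift p y : sublinear p -> exists q,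
  [/\ sublinear q, forall x, q x <= p x & forall x, q x <= p (x + y) - p y].
Proof.
move=> sp; pose r (t : R) x := p (x + t *: y) - t * p y.
pose Q := [set r t | t in [set t : R | 0 <= t]].
have Qb q x : Q q -> - p (- x) <= q x.
  move=> [t t0 <-]; have := sp.1 (x + t *: y) (- x).
  by rewrite addrAC subrr add0r sp.2// /r; lra.
exists (fun x => inf [set q x | q in Q]); split.
- apply: (@sublinear_inf Q (fun x => - p (- x))) => //.
  + by exists (r 0), 0 => /=.
  + move=> _ _ x x' [s s0 <-] [t t0 <-]; exists (r (s + t)).
      by exists (s + t) => //=; rewrite addr_ge0.
    rewrite /r scalerDl addrACA mulrDl.
    have := sp.1 (x + s *: y) (x' + t *: y) => H.
    lra.
  + move=> _ c x [t t0 <-] c0; exists (r (c * t)).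
      by exists (c * t) => //=; rewrite mulr_ge0// ltW.
    by rewrite /r -scalerA -scalerDr sp.2 ?(ltW c0)//; lra.
- move=> x; rewrite (_ : p x = r 0 x); last first.
    by rewrite /r scale0r addr0 mul0r subr0.
  apply: ge_inf; first by exists (- p (- x)) => _ [q Qq <-]; exact: Qb.
  by exists (r 0) => //; exists 0 => /=.
- move=> x; rewrite (_ : _ - _ = r 1 x); last by rewrite /r scale1r mul1r.
  apply: ge_inf; first by exists (- p (- x)) => _ [q Qq <-]; exact: Qb.
  by exists (r 1) => //; exists 1 => /=.
Qed.

(* A pointwise minimal sublinear functional [p] equals each of its shifts
   [sublinear_shift p y], which makes it additive. *)
Lemma hahn_banach p0 : sublinear p0 ->
  exists f : {scalar X}, forall x, f x <= p0 x.
Proof.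
move=> sp0.
pose T := {p : X -> R | sublinear p /\ forall x, p x <= p0 x}.
(* The pointwise order is reversed, so that a maximal element is a minimal sublinear functional. *)
pose le_p (p q : T) := `[< forall x, sval q x <= sval p x >].
have [|||A totA|[p [sp pp0]] pmin] := @Zorn T le_p.
- by move=> p; apply/asboolP.
- move=> p q r /asboolP pq /asboolP qr; apply/asboolP => x.
  exact: le_trans (qr x) (pq x).
- move=> [p Pp] [q Pq] /asboolP/= pq /asboolP/= qp; apply/eq_exist/funext => x.
  by apply/eqP; rewrite eq_le qp pq.
- have [A0|/set0P[a0 Aa0]] := eqVneq A set0.
    exists (exist _ p0 (conj sp0 (fun x => lexx (p0 x)))) => s.
    by rewrite A0.
  pose Q := [set sval a | a in A].
  have Qb q x : Q q -> - p0 (- x) <= q x.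
    move=> [[q' [sq' q'p0]] _ <-] /=; apply: le_trans (sublinear_ge _ sq').
    by rewrite lerN2.
  have sI : sublinear (fun x => inf [set q x | q in Q]).
    apply: (@sublinear_inf Q (fun x => - p0 (- x))) => //.
    + by exists (sval a0), a0.
    + move=> _ _ x y [a Aa <-] [a' Aa' <-].
      have [/asboolP aa'|/asboolP a'a] := totA _ _ Aa Aa'.
        exists (sval a'); first by exists a'.
        by have [[+ _] _] := svalP a' => /(_ x y)/le_trans; apply; rewrite lerD2r.
      exists (sval a); first by exists a.
      by have [[+ _] _] := svalP a => /(_ x y)/le_trans; apply; rewrite lerD2l.
    + move=> _ t x [a Aa <-] t0; exists (sval a); first by exists a.
      by have [[_ pZ] _] := svalP a; rewrite pZ ?(ltW t0).
  have Ile q x : Q q -> inf [set q x | q in Q] <= q x.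
    move=> Qq; apply: ge_inf; last by exists q.
    by exists (- p0 (- x)) => _ [q' Qq' <-]; exact: Qb.
  have Ip0 x : inf [set q x | q in Q] <= p0 x.
    by apply: le_trans (Ile (sval a0) _ _) _; [exists a0|have [_] := svalP a0].
  exists (exist _ (fun x => inf [set q x | q in Q]) (conj sI Ip0)) => a Aa.
  by apply/asboolP => x /=; apply: Ile; exists a.
have padd x y : p (x + y) = p x + p y.
  apply/eqP; rewrite eq_le sp.1/=.
  have [q [sq qp qy]] := sublinear_shift y sp.
  have qp0 z : q z <= p0 z by exact: le_trans (qp z) (pp0 z).
  have : le_p (exist _ p (conj sp pp0)) (exist _ q (conj sq qp0)) by apply/asboolP.
  move=> /pmin/(congr1 sval)/= qE.
  by rewrite -lerBrDr; move: (qy x); rewrite {1}qE.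
have pN x : p (- x) = - p x.
  by apply/eqP; rewrite -addr_eq0 -padd addNr (sublinear0 sp).
have plin : linear_for *%R p.
  move=> a x y; rewrite padd; congr (_ + _).
  have [a0|/ltW a0] := leP 0 a; first exact: sp.2.
  by rewrite -[a]opprK scaleNr pN sp.2 ?oppr_ge0// !mulNr.
pose f : {scalar X} := HB.pack_for {scalar X} p
  (GRing.isLinear.Build R X R *%R p plin).
by exists f.
Qed.
End Sublinear.

Definition dual_ball (R : realType) (X : normedModType R)
  (f : {scalar X}) := forall x, `|f x| <= `|x|.

(** Hahn-Banach is applied to the norm shifted by [z]: the bound at [- z] is [- |z|], which forces
    [f z >= |z|]. *)
Lemma exists_norming (R : realType) (X : normedModType R) (z : X) :
  exists2 f : {scalar X}, dual_ball f & f z = `|z|.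
Proof.
have sn : sublinear (fun x : X => `|x|).
  split=> [x y|t x t0]; first exact: ler_normD.
  by rewrite normrZ ger0_norm.
have [q [sq q1 q2]] := sublinear_shift z sn.
have [f fq] := hahn_banach sq.
have fb : dual_ball f.
  move=> x; have fN z' : f z' <= `|z'| by exact: le_trans (fq _) (q1 _).
  by rewrite ler_norml fN andbT lerNl -[leLHS](linearN f) -(normrN x) fN.
exists f => //; apply/eqP; rewrite eq_le (le_trans (ler_norm _) (fb z))/=.
have := le_trans (fq (- z)) (q2 (- z)).
by rewrite addNr normr0 sub0r linearN lerN2.
Qed.

(** * Finite-range approximation of the dual ball *)

Lemma real_cells (R : realType) (C eta : R) : 0 < eta ->
  exists (L : nat) (cell : R -> 'I_L.+1), forall x y, `|x| <= C -> `|y| <= C ->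
    cell x = cell y -> `|x - y| <= eta.
Proof.
move=> eta0; exists (Num.truncn ((C + C) / eta)).
exists (fun x => inord (Num.truncn ((x + C) / eta))) => x y.
move=> /ler_normlP[xC1 xC2] /ler_normlP[yC1 yC2] /(congr1 val).
have trunc_le z : z <= C -> (Num.truncn ((z + C) / eta) <
    (Num.truncn ((C + C) / eta)).+1)%N.
  by move=> zC; rewrite ltnS le_truncn// ler_pM2r ?invr_gt0// lerD2r.
rewrite /= !inordK ?trunc_le// => txy.
have ge0 z : - z <= C -> 0 <= (z + C) / eta.
  by move=> zC; rewrite divr_ge0 ?(ltW eta0)//; lra.
have /andP[x1 x2] := truncn_itv (ge0 x xC1).
have /andP[y1 y2] := truncn_itv (ge0 y yC1).
rewrite txy in x1 x2; rewrite -natr1 in x2 y2.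
rewrite ler_pdivlMr// in x1; rewrite ler_pdivlMr// in y1.
rewrite ltr_pdivrMr// in x2; rewrite ltr_pdivrMr// in y2.
by rewrite ler_norml; apply/andP; split; lra.
Qed.

Lemma vector_cells (R : realType) (I : finType) (C eta : R) : 0 < eta ->
  exists (F : finType) (cell : (I -> R) -> F), forall u v,
    (forall i, `|u i| <= C) -> (forall i, `|v i| <= C) -> cell u = cell v ->
    forall i, `|u i - v i| <= eta.
Proof.
move=> /(real_cells C)[L [cell cellP]].
exists {ffun I -> 'I_L.+1}, (fun u => [ffun i => cell (u i)]).
by move=> u v uC vC /ffunP uv i; apply: cellP => //; have := uv i; rewrite !ffunE.
Qed.

(** Pigeonhole: from index [N] on, take one more term than there are cells. *)
Lemma bounded_seq_near_pair (R : realType) (I : finType) (a : nat -> I -> R)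
    (C eta : R) (N : nat) : 0 < eta -> (forall j i, `|a j i| <= C) ->
  exists j j', (N <= j < j')%N /\ forall i, `|a j i - a j' i| <= eta.
Proof.
move=> /(vector_cells I C)[F [cell cellP]] aC.
pose h (k : 'I_#|F|.+1) := cell (a (N + k)%N).
have /injectivePn[k [k' kk' hkk']] : ~~ injectiveb h.
  by apply/negP => /injectiveP/leq_card; rewrite card_ord ltnn.
wlog lt_kk' : k k' kk' hkk' / (k < k')%N.
  move=> wl; have [|ge_kk'|/val_inj eq_kk'] := ltngtP k k'; first exact: wl.
    by apply: (wl k' k) => //; rewrite eq_sym.
  by rewrite eq_kk' eqxx in kk'.
exists (N + k)%N, (N + k')%N; rewrite leq_addr ltn_add2l lt_kk'; split=> //.
by apply: cellP => //; exact: hkk'.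
Qed.

Lemma dual_ball0 (R : realType) (X : normedModType R) :
  dual_ball (\0 : {scalar X}).
Proof. by move=> x; rewrite /= normr0. Qed.

Lemma separable_dense_seq (R : realType) (X : normedModType R) : separable X ->
  exists d : nat -> X, forall x e, 0 < e -> exists j, `|x - d j| < e.
Proof.
move=> [D [/countable_injP[f finj] dD]].
have /choice[d dP] n : exists x, forall y, D y -> f y = n -> y = x.
  have [[y [Dy fy]]|ny] := pselect (exists y, D y /\ f y = n).
    exists y => z Dz fz; apply: finj; rewrite ?inE//; congruence.
  by exists 0 => y Dy fy; exfalso; apply: ny; exists y.
exists d => x e e0.
have [y []] := dD (ball x e) (ex_intro _ x (ballxx x e0)) (@ball_open _ _ x e).
by rewrite -ball_normE /= => xy Dy; exists (f y); rewrite -(dP _ _ Dy erefl).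
Qed.

Definition finite_range (R : realType) (X : normedModType R)
    (P : {scalar X} -> {scalar X}) :=
  exists (F : finType) (g : F -> {scalar X}),
    (forall i, dual_ball (g i)) /\
    (forall phi, dual_ball phi -> exists i, P phi = g i).

(** [approx0] makes every variation from index 0 start at the value 0. In [approx_cvg] the stage [M]
    does not depend on [phi]. *)
Record approximation (R : realType) (X : normedModType R) := Approximation {
  approx :> nat -> {scalar X} -> {scalar X};
  approx_ball : forall m phi, dual_ball phi -> dual_ball (approx m phi);
  approx_finite : forall m, finite_range (approx m);
  approx0 : forall phi x, approx 0%N phi x = 0;
  approx_cvg : forall x e, 0 < e -> exists M, forall m phi, (M <= m)%N ->
    dual_ball phi -> `|approx m phi x - phi x| <= e
}.

(* The net of the dual ball at stage [m] only has to be fine for the weak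
   topology of the first [m] terms of a dense sequence, so it can be finite. *)
Lemma separable_approximation (R : realType) (X : normedModType R) :
  separable X -> inhabited (approximation X).
Proof.
move=> /separable_dense_seq[d dP].
have /choice[P PP] (m : nat) : exists Pm : {scalar X} -> {scalar X},
  [/\ forall phi, dual_ball phi -> dual_ball (Pm phi), finite_range Pm,
      m = 0%N -> forall phi x, Pm phi x = 0 &
      forall phi j, dual_ball phi -> (j < m)%N ->
        `|Pm phi (d j) - phi (d j)| <= m%:R^-1].
  have [->|m0] := posnP m.
    exists (fun=> \0); split=> //; first by move=> *; exact: dual_ball0.
    exists unit, (fun=> \0); split; first by move=> *; exact: dual_ball0.
    by move=> *; exists tt.
  pose C := \sum_(i < m) `|d i|.
  have dC phi : dual_ball phi -> forall i : 'I_m, `|phi (d i)| <= C.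
    move=> bphi i; apply: le_trans (bphi _) _.
    by rewrite /C (bigD1 i)//= lerDl sumr_ge0.
  have im0 : 0 < m%:R^-1 :> R by rewrite invr_gt0 ltr0n.
  have [F [cell cellP]] := vector_cells 'I_m C im0.
  pose c (phi : {scalar X}) := cell (fun i : 'I_m => phi (d i)).
  (* One representative of each cell that meets the dual ball, and the zero functional for the other
     cells. *)
  have /choice[g gP] k : exists psi : {scalar X}, dual_ball psi /\
      forall phi, dual_ball phi -> c phi = k -> c psi = k.
    have [[psi [bpsi cpsi]]|no] := pselect (exists psi, dual_ball psi /\ c psi = k).
      by exists psi; split.
    exists \0; split; first exact: dual_ball0.
    by move=> phi bphi ck; exfalso; apply: no; exists phi.
  exists (fun phi => g (c phi)); split.
  - by move=> phi _; have [] := gP (c phi).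
  - exists F, g; split=> [i|phi _]; first by have [] := gP i.
    by exists (c phi).
  - by move=> m0'; rewrite m0' in m0.
  - move=> phi j bphi jm; have [bg /(_ phi bphi erefl) cg] := gP (c phi).
    exact: (cellP _ _ (dC _ bg) (dC _ bphi) cg (Ordinal jm)).
constructor; apply: (@Approximation R X P).
- by move=> m phi; have [+ _ _ _] := PP m; exact.
- by move=> m; have [] := PP m.
- by move=> phi x; have [_ _ + _] := PP 0%N; exact.
move=> x e e0; have e3 : 0 < e / 3 by rewrite divr_gt0.
have [j jx] := dP x _ e3.
exists (maxn j.+1 (Num.truncn (e / 3)^-1).+1) => m phi.
rewrite geq_max => /andP[jm tm] bphi.
have [/(_ _ bphi) bP _ _ /(_ _ j bphi jm) Pd] := PP m.
have me : m%:R^-1 <= e / 3.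
  rewrite invf_ple ?posrE ?ltr0n ?(leq_trans _ jm)//.
  apply: le_trans (_ : (Num.truncn (e / 3)^-1).+1%:R <= _); last by rewrite ler_nat.
  by rewrite ltW// truncnS_gt.
have -> : P m phi x - phi x = P m phi (x - d j) +
    (P m phi (d j) - phi (d j)) - phi (x - d j).
  by rewrite (linearB phi) (linearB (P m phi)); ring.
apply: le_trans (ler_normB _ _) _; apply: le_trans (lerD (ler_normD _ _) (bphi _)) _.
have := bP (x - d j); lra.
Qed.

(** * The variation norm *)

Section Variation.
Context (R : realType).
Implicit Types (a b : nat -> R) (p q : nat) (s t : seq nat).

Fixpoint variation a p s : R :=
  if s is q :: s' then `|a q - a p| + variation a q s' else 0.

Lemma variation_ge0 a p s : 0 <= variation a p s.
Proof. by elim: s p => //= q s IH p; rewrite addr_ge0. Qed.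

Lemma variationD a b p s :
  variation (fun m => a m + b m) p s <= variation a p s + variation b p s.
Proof.
elim: s p => [|q s IH] p /=; first by rewrite addr0.
rewrite addrACA lerD// opprD addrACA; exact: ler_normD.
Qed.

Lemma variationZ (c : R) a p s :
  variation (fun m => c * a m) p s = `|c| * variation a p s.
Proof.
by elim: s p => [|q s IH] p /=; rewrite ?mulr0// -mulrBr normrM IH mulrDr.
Qed.

Lemma variation_le a (B : R) p s : (forall m, `|a m| <= B) ->
  variation a p s <= (size s)%:R * (B + B).
Proof.
move=> aB; elim: s p => [|q s IH] p /=; first by rewrite mul0r.
rewrite -natr1 mulrDl mul1r addrC lerD//.
by apply: le_trans (ler_normB _ _) _; rewrite lerD.
Qed.

Lemma variation_cat a p s t :
  variation a p (s ++ t) = variation a p s + variation a (last p s) t.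
Proof. by elim: s p => [|q s IH] p /=; rewrite ?add0r// IH addrA. Qed.

Lemma variation_triangle a p q s :
  variation a p s <= `|a q - a p| + variation a q s.
Proof.
case: s => [|r s] /=; first by rewrite addr0.
rewrite addrA lerD2r addrC.
by rewrite (le_trans _ (ler_normD _ _))// subrKA.
Qed.

Lemma variation_subseq a p s t : subseq s t -> variation a p s <= variation a p t.
Proof.
elim: t p s => [|q t IH] p [|r s] //=; first by rewrite addr_ge0// variation_ge0.
case: eqVneq => [->|_] st; first by rewrite lerD2l IH.
exact: le_trans (IH p _ st) (variation_triangle _ _ _ _).
Qed.

(** As [t] contains every point of [ms] beyond [p], no point of [ms] lies strictly between
    consecutive points of the partition, and each increment costs at most [e]. *)
Lemma variation_close a b p (ms t : seq nat) (e : R) :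
  path leq p t -> (forall m, m \in ms -> (m <= p)%N || (m \in t)) ->
  (forall p q, (p <= q)%N -> (forall m, m \in ms -> (m <= p)%N || (q <= m)%N) ->
    `|a q - a p| <= `|b q - b p| + e) ->
  variation a p t <= variation b p t + (size t)%:R * e.
Proof.
move=> + + ab; elim: t p => [|q t IH] p /=; first by rewrite mul0r addr0.
move=> /andP[pq qt] mst.
have qmin m : m \in t -> (q <= m)%N.
  by move: m; apply/allP; exact: order_path_min leq_trans qt.
have qt' m : m \in ms -> (m <= q)%N || (m \in t).
  by move=> /mst; rewrite inE => /or3P[/leq_trans->|/eqP->|->]//; rewrite ?leqnn ?orbT.
have pq' m : m \in ms -> (m <= p)%N || (q <= m)%N.
  by move=> /mst; rewrite inE => /or3P[->|/eqP->|/qmin->]//; rewrite ?leqnn ?orbT.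
have := ab p q pq pq'; have := IH q qt qt'.
rewrite -natr1 mulrDl mul1r; lra.
Qed.
End Variation.

Section SignInsensitive.
Context (R : realType) (X : normedModType R) (A : approximation X).

(** The list [s] omits the initial point 0, so [k] bounds the number of increments. *)
Definition variation_norm (k : nat) (N : X -> R) :=
  (forall phi s x, dual_ball phi -> path leq 0%N s -> (size s <= k)%N ->
    variation (fun m => A m phi x) 0 s <= N x) /\
  (forall x B, (forall phi s, dual_ball phi -> path leq 0%N s -> (size s <= k)%N ->
    variation (fun m => A m phi x) 0 s <= B) -> N x <= B).

Lemma exists_variation_norm (k : nat) : (0 < k)%N ->
  exists N : equivalent_norm X, variation_norm k N.
Proof.
move=> k0.
pose Q := [set q : X -> R | exists phi s, [/\ dual_ball phi, path leq 0%N s,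
  (size s <= k)%N & q = fun x => variation (fun m => A m phi x) 0 s]].
have [|||||N [leN Nle]] := @equivalent_norm_sup R X Q 1 (k%:R * 2); first by [].
- move=> _ [phi [s [bphi s0 sk ->]]] x y; apply: le_trans (variationD _ _ _ _).
  by rewrite le_eqVlt; apply/predU1l; congr variation; apply/funext => m; rewrite linearD.
- move=> _ [phi [s [bphi s0 sk ->]]] c x; rewrite -variationZ.
  by congr variation; apply/funext => m; rewrite linearZ.
- move=> _ [phi [s [bphi s0 sk ->]]] x; apply: le_trans (variation_le _ _ _) _.
    by move=> m; exact: (approx_ball A m bphi x).
  by rewrite -mulrA [2 * _]mulr_natl mulr2n ler_wpM2r ?ler_nat// addr_ge0.
- move=> x e e0; have [phi bphi phix] := exists_norming x.
  have [M AM] := approx_cvg A x e0.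
  (* The single increment from 0 to a late stage [M] already nearly recovers [phi x], which equals
     [|x|]. *)
  exists (fun x => variation (fun m => A m phi x) 0 [:: M]).
    by exists phi, [:: M].
  rewrite /= approx0 subr0 addr0 mul1r.
  have := AM M phi (leqnn M) bphi; rewrite phix => AMx.
  rewrite lerBlDr addrC -lerBlDr -[X in X - _]normr_id.
  apply: le_trans (lerB_dist _ _) _; rewrite distrC; exact: AMx.
exists N; split=> [phi s x bphi s0 sk|x B NB].
  by apply: (leN (fun x => variation (fun m => A m phi x) 0 s)); exists phi, s.
by apply: Nle => _ [phi [s [bphi s0 sk ->]]]; exact: NB.
Qed.

(** At most one [D i] exceeds [d]. Its absolute value is unchanged by [c i], and the other terms
    alter each sum by at most [n * d]. *)
Lemma norm_sum_le_signed (n : nat) (D c : 'I_n -> R) (d : R) :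
  0 <= d -> (forall i, `|c i| = 1) ->
  (forall i j, i != j -> `|D i| <= d \/ `|D j| <= d) ->
  `|\sum_i D i| <= `|\sum_i c i * D i| + n%:R * (d + d).
Proof.
move=> d0 c1 Dd.
have sum_le (P : pred 'I_n) (F : 'I_n -> R) :
    (forall i, P i -> `|F i| <= d) -> `|\sum_(i | P i) F i| <= n%:R * d.
  move=> Fd; apply: le_trans (ler_norm_sum _ _ _) _.
  apply: le_trans (ler_sum _ Fd) _.
  rewrite sumr_const -[leLHS]mulr_natl ler_wpM2r// ler_nat.
  by rewrite -[leqRHS]card_ord max_card.
have [[i di]|allD] := pselect (exists i, d < `|D i|); last first.
  apply: le_trans (sum_le predT _ _) _.
    by move=> i _; rewrite leNgt; apply/negP => Di; apply: allD; exists i.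
  by rewrite mulrDr addrA lerDr addr_ge0// mulr_ge0.
have Dj j : j != i -> `|D j| <= d.
  by move=> /Dd[]//; rewrite leNgt di.
have cDj j : j != i -> `|c j * D j| <= d by move=> ji; rewrite normrM c1 mul1r Dj.
rewrite (bigD1 i)//= [in leRHS](bigD1 i)//=.
have := sum_le _ _ Dj; have := sum_le _ _ cDj.
set u := \sum_(_ | _) _; set v := \sum_(_ | _) _ => Hu Hv.
have H1 : `|D i| <= `|c i * D i + u| + `|u|.
  by rewrite -[`|D i|]mul1r -(c1 i) -normrM -{1}(addrK u (c i * D i)) ler_normB.
have := ler_normD (D i) v; rewrite mulrDr; lra.
Qed.

(* Refining a partition by the block ends [ms] makes each increment see at most
   one block, so signs become irrelevant; the refined partition splits into two
   partitions of admissible size. *)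
Lemma variation_norm_signed (n : nat) (N : X -> R) (w : 'I_n -> X)
    (c : 'I_n -> R) (ms : nat -> nat) (e : R) :
  variation_norm n.+1 N -> 0 <= e -> (forall i, `|c i| = 1) ->
  {homo ms : i j / (i <= j)%N} ->
  (forall (i : 'I_n) phi m, dual_ball phi -> (m <= ms i)%N ->
    `|A m phi (w i)| <= e) ->
  (forall (i : 'I_n) phi m, dual_ball phi -> (ms i.+1 <= m)%N ->
    `|A m phi (w i) - phi (w i)| <= e) ->
  N (\sum_i w i) <= N (\sum_i c i *: w i) *+ 2 +
    (n.*2.+1)%:R * (n%:R * (e *+ 4)).
Proof.
move=> [leN Nle] e0 c1 ms_homo w_lo w_hi; apply: Nle => phi s bphi s0 sn.
set x' := \sum_i c i *: w i.
pose a m := A m phi (\sum_i w i); pose a' m := A m phi x'.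
pose mt := [seq ms i.+1 | i <- iota 0 n].
pose t := sort leq (s ++ mt).
have tE : size t = (size s + n)%N by rewrite size_sort size_cat size_map size_iota.
have st : subseq s t.
  rewrite -(sorted_sort leq_trans (path_sorted s0)).
  exact: (subseq_sort leq_total leq_trans (prefix_subseq _ _)).
have t0 : path leq 0%N t.
  by rewrite path_sortedE ?(sort_sorted leq_total) ?andbT; [apply/allP|exact: leq_trans].
have step p q : (p <= q)%N ->
    (forall m, m \in mt -> (m <= p)%N || (q <= m)%N) ->
    `|a q - a p| <= `|a' q - a' p| + n%:R * (e *+ 4).
  move=> pq pqm.
  pose D i := A q phi (w i) - A p phi (w i).
  have -> : a q - a p = \sum_i D i.
    by rewrite /a (linear_sum (A q phi)) (linear_sum (A p phi))/= -sumrB.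
  have -> : a' q - a' p = \sum_i c i * D i.
    rewrite /a' /x' (linear_sum (A q phi)) (linear_sum (A p phi))/= -sumrB; apply: eq_bigr => i _.
    by rewrite (scalarZ (A q phi)) (scalarZ (A p phi)) mulrBr.
  (* Block [i] acts only between [ms i] and [ms i.+1]: earlier its values are small, later they are
     nearly the constant [phi (w i)]. *)
  have lo (i : 'I_n) : (q <= ms i)%N -> `|D i| <= e *+ 2.
    move=> qi; apply: le_trans (ler_normB _ _) _; rewrite mulr2n lerD// w_lo//.
    exact: leq_trans qi.
  have hi (i : 'I_n) : (ms i.+1 <= p)%N -> `|D i| <= e *+ 2.
    move=> ip; have -> : D i = (A q phi (w i) - phi (w i)) - (A p phi (w i) - phi (w i)).
      by rewrite /D; ring.
    apply: le_trans (ler_normB _ _) _; rewrite mulr2n lerD// w_hi//.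
    exact: leq_trans pq.
  (* The block end [ms i.+1] is not strictly inside the step, so either block [i] has ended by [p],
     or block [j] has not begun at [q]. *)
  have lt_case (i j : 'I_n) : (i < j)%N -> `|D i| <= e *+ 2 \/ `|D j| <= e *+ 2.
    move=> ij; have /orP[|qi] : (ms i.+1 <= p)%N || (q <= ms i.+1)%N.
    - by apply: pqm; rewrite map_f// mem_iota/=.
    - by left; exact: hi.
    by right; apply: lo; apply: leq_trans qi _; exact: ms_homo.
  apply: le_trans (norm_sum_le_signed (d := e *+ 2) (c := c) _ _ _) _ => //.
  - by rewrite mulrn_wge0.
  - move=> i j; rewrite neq_ltn => /orP[|/lt_case[]]; [exact: lt_case|by right|by left].
  by rewrite lerD2l -mulrnDr.
have mst m : m \in mt -> (m <= 0)%N || (m \in t).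
  by move=> mmt; rewrite mem_sort mem_cat mmt !orbT.
apply: le_trans (variation_subseq _ _ st) _.
apply: le_trans (variation_close (b := a') t0 mst step) _.
have x'0 : 0 <= N x' by exact: le_trans (leN phi [::] x' bphi isT isT).
apply: lerD; last first.
  rewrite ler_wpM2r ?mulr_ge0 ?mulrn_wge0// ler_nat tE.
  by rewrite -addnn -addSn leq_add2r.
(* [t] has at most [2n + 1] points. The first [n + 1] form one admissible partition; the others, at
   most [n], form a second one when preceded by [l], the last point of the first. *)
move: (t0); rewrite -{1}(cat_take_drop n.+1 t) cat_path => /andP[t1 t2].
rewrite -[X in variation _ _ X](cat_take_drop n.+1 t) variation_cat mulr2n lerD//.
  by apply: leN => //; rewrite size_take; case: ltnP.
set l := last _ _ in t2 *.
apply: le_trans (leN phi (l :: drop n.+1 t) x' bphi _ _) => /=.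
- by rewrite lerDr.
- by [].
- by rewrite size_drop tE ltnS leq_subLR leq_add2r.
Qed.
End SignInsensitive.

(** * Almost biorthogonal systems *)

Lemma history_choice (T : Type) (Q : seq T -> T -> Prop) :
  (forall L, exists a, Q L a) -> exists u, forall k, Q (mkseq u k) (u k).
Proof.
move=> /choice[h hP].
pose hist := nat_rect (fun=> seq T) [::] (fun _ L => rcons L (h L)).
pose u k := h (hist k).
have histE k : hist k = mkseq u k by elim: k => //= k IH; rewrite mkseqS -IH.
by exists u => k; rewrite -histE; exact: hP.
Qed.

(** The common kernel has finite codimension: each new functional costs at most one more spanning
    vector. *)
Lemma common_kernel_codim (R : realType) (X : normedModType R)
    (g : nat -> {scalar X}) (m : nat) : exists n (v : 'I_n -> X), forall x,
  exists (c : 'I_n -> R) y,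
    x = \sum_i c i *: v i + y /\ forall j, (j < m)%N -> g j y = 0.
Proof.
elim: m => [|m [n [v vP]]].
  exists 0%N, (fun=> 0) => x; exists (fun=> 0), x; split=> //.
  by rewrite big_ord0 add0r.
have [g0|] := pselect (forall y, (forall j, (j < m)%N -> g j y = 0) -> g m y = 0).
  exists n, v => x; have [c [y [-> gy]]] := vP x; exists c, y; split=> // j.
  by rewrite ltnS leq_eqVlt => /predU1P[->|/gy//]; exact: g0.
move=> /existsNP[y0 /not_implyP[gy0 /eqP gmy0]].
(* [y0] is the new spanning vector, at index [ord0]; subtracting [t *: y0] kills [g m] and leaves
   the earlier functionals at 0. *)
exists n.+1, (fun i => oapp v y0 (unlift ord0 i)) => x.
have [c [y [-> gy]]] := vP x; pose t := g m y / g m y0.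
exists (fun i => oapp c t (unlift ord0 i)), (y - t *: y0); split.
  rewrite big_ord_recl unlift_none/=.
  under [in RHS]eq_bigr => i _ do rewrite liftK /=.
  by rewrite [t *: y0 + _]addrC -addrA [t *: y0 + _]addrC subrK.
move=> j; rewrite linearB scalarZ ltnS leq_eqVlt => /predU1P[->|jm].
  by rewrite divfK// subrr.
by rewrite gy// gy0// mulr0 subrr.
Qed.

Lemma unit_vector_in_kernel (R : realType) (X : normedModType R)
    (g : nat -> {scalar X}) (m : nat) : ~ finite_dimensional X ->
  exists z : X, `|z| = 1 /\ forall j, (j < m)%N -> g j z = 0.
Proof.
move=> infX; have [n [v vP]] := common_kernel_codim g m.
have [y [y0 gy]] : exists y : X, y != 0 /\ forall j, (j < m)%N -> g j y = 0.
  apply: contrapT => /forallNP ker0; apply: infX; exists n, v => x.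
  have [c [y [xE gy]]] := vP x; exists c; rewrite xE.
  have [->|y0] := eqVneq y 0; first by rewrite addr0.
  by exfalso; apply: (ker0 y).
exists (`|y|^-1 *: y); split; first by rewrite normrZ normfV normr_id mulVf ?normr_eq0.
by move=> j jm; rewrite scalarZ gy// mulr0.
Qed.

(* Take unit vectors [z k] annihilated by [g j], [j < k], with [g k] norming
   [z k]. Differences [g b - g a] keep this triangularity, and by pigeonhole they
   can be chosen small at finitely many prescribed vectors. *)
Lemma almost_biorthogonal (R : realType) (X : normedModType R) (d : R) :
  ~ finite_dimensional X -> 0 < d ->
  exists (e : nat -> X) (f : nat -> {scalar X}),
    [/\ forall n, `|e n| = 1, forall n x, `|f n x| <= 2 * `|x|,
        forall n, f n (e n) = 1 & forall m n, m != n -> `|f m (e n)| <= d].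
Proof.
move=> infX d0; pose zg0 : X * {scalar X} := (0, (\0 : {scalar X})).
have [zg zgP] : exists zg : nat -> X * {scalar X}, forall k,
    [/\ `|(zg k).1| = 1, dual_ball (zg k).2, (zg k).2 (zg k).1 = 1 &
        forall j, (j < k)%N -> (zg j).2 (zg k).1 = 0].
  have [|zg zgP] := @history_choice (X * {scalar X}) (fun L a =>
    [/\ `|a.1| = 1, dual_ball a.2, a.2 a.1 = 1 &
        forall j, (j < size L)%N -> (nth zg0 L j).2 a.1 = 0]).
    move=> L; have [z [z1 gz]] :=
      unit_vector_in_kernel (fun j => (nth zg0 L j).2) (size L) infX.
    by have [g bg gzE] := exists_norming z; exists (z, g); split=> //=; rewrite gzE.
  exists zg => k; have [? ? ? gz] := zgP k; split=> // j jk.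
  by have := gz j; rewrite size_mkseq nth_mkseq//; exact.
pose z k := (zg k).1; pose g k := (zg k).2.
have [ab abP] : exists ab : nat -> nat * nat, forall k, ((ab k).1 < (ab k).2)%N /\
    forall i, (i < k)%N -> ((ab i).2 < (ab k).1)%N /\
      `|g (ab k).2 (z (ab i).2) - g (ab k).1 (z (ab i).2)| <= d.
  have [|ab abP] := @history_choice (nat * nat) (fun L a => (a.1 < a.2)%N /\
    forall i, (i < size L)%N -> ((nth (0, 0)%N L i).2 < a.1)%N /\
      `|g a.2 (z (nth (0, 0)%N L i).2) - g a.1 (z (nth (0, 0)%N L i).2)| <= d).
    move=> L; pose b i := (nth (0, 0)%N L i).2.
    have [|a [a' [/andP[La aa'] near]]] := @bounded_seq_near_pair R 'I_(size L)
      (fun j i => g j (z (b i))) 1 d (\max_(i < size L) b i).+1 d0.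
      by move=> j i; have [_ + _ _] := zgP j => /(_ (z (b i))); have [-> _ _ _] := zgP (b i).
    exists (a, a'); split=> //= i iL; split.
      by apply: leq_trans La; rewrite ltnS; exact: (leq_bigmax (Ordinal iL)).
    by rewrite distrC; exact: (near (Ordinal iL)).
  exists ab => k; have [? near] := abP k; split=> // i ik.
  by have := near i; rewrite size_mkseq nth_mkseq//; exact.
(* Triangularity gives 1 on the diagonal and 0 for [m < n]; the choice of the pairs gives the bound
   [d] for [n < m]. *)
exists (fun n => z (ab n).2), (fun n => g (ab n).2 \- g (ab n).1); split.
- by move=> n; have [] := zgP (ab n).2.
- move=> n x; apply: le_trans (ler_normB _ _) _; rewrite mulr_natl mulr2n.
  by apply: lerD; [have [_ + _ _] := zgP (ab n).2|have [_ + _ _] := zgP (ab n).1]; exact.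
- move=> n /=; have [_ _ gz gz0] := zgP (ab n).2.
  by rewrite /g /z gz gz0 ?subr0//; have [] := abP n.
move=> m n; rewrite neq_ltn => /orP[mn|nm] /=; last first.
  by have [_ /(_ _ nm)[]] := abP m.
have [_ _ _ gz0] := zgP (ab n).2.
have [lt_n /(_ _ mn)[lt_mn _]] := abP n; have [lt_m _] := abP m.
have lt_mb := ltn_trans lt_mn lt_n.
by rewrite /g /z !gz0 ?subrr ?normr0 ?(ltW d0)// (ltn_trans lt_m).
Qed.

(** * The branch norm *)

Section BranchNorm.
Context (R : realType) (X : normedModType R).
Implicit Types (s r : seq nat) (f : seq nat -> {scalar X}).

(** The prefixes run from length 1 up to [s] itself; the root contributes nothing. *)
Definition branch_sum f s (x : X) := \sum_(l < size s) f (take l.+1 s) x.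

Lemma exists_branch_norm (n : nat) (eps : R) f : 0 < eps ->
  (forall s x, `|f s x| <= 2 * `|x|) ->
  exists N : equivalent_norm X,
    (forall s x, (size s <= n)%N -> `|branch_sum f s x| <= N x) /\
    (forall x B, (forall s, (size s <= n)%N -> `|branch_sum f s x| <= B) ->
       N x <= eps * `|x| + B).
Proof.
move=> eps0 f2.
pose q s x := eps * `|x| + `|branch_sum f s x|.
have [|||||N [leN Nle]] := @equivalent_norm_sup R X
  [set q s | s in [set s | (size s <= n)%N]] eps (eps + n%:R * 2); first by [].
- move=> _ [s _ <-] x y; rewrite /q addrACA -mulrDr lerD//.
    by rewrite ler_pM2l// ler_normD.
  rewrite /branch_sum; under eq_bigr => i _ do rewrite linearD.
  by rewrite big_split ler_normD.
- move=> _ [s _ <-] a x; rewrite /q normrZ mulrDr mulrCA -normrM; congr (_ + `|_|).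
  by rewrite /branch_sum mulr_sumr; apply: eq_bigr => i _; rewrite scalarZ.
- move=> _ [s sn <-] x; rewrite /q mulrDl lerD2l -mulrA.
  apply: le_trans (ler_norm_sum _ _ _) _.
  apply: (@le_trans _ _ (\sum_(l < size s) 2 * `|x|)); first exact: ler_sum.
  by rewrite sumr_const card_ord -[leLHS]mulr_natl ler_wpM2r ?ler_nat// mulr_ge0.
- move=> x e e0; exists (q [::]); first by exists [::].
  by rewrite /q lerBlDr -addrA lerDl addr_ge0// ltW.
exists N; split=> [s x sn|x B sB].
  apply: le_trans (leN (q s) x _); last by exists s.
  by rewrite /q lerDr mulr_ge0// ltW.
by apply: Nle => _ [s sn <-]; rewrite lerD2l sB.
Qed.
End BranchNorm.

(* [sg k] is the node at level [k] of a branch of the tree of finite sequences,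
   and [rcons (sg k) (j' k)] is a sibling of the next node of that branch. *)
Section Branch.
Context (R : realType) (sg : nat -> seq nat) (j j' : nat -> nat).
Hypotheses (sg0 : sg 0%N = [::]) (sgS : forall k, sg k.+1 = rcons (sg k) (j k)).
Hypothesis jj' : forall k, j k != j' k.

Lemma size_branch k : size (sg k) = k.
Proof. by elim: k => [|k IH]; rewrite ?sg0// sgS size_rcons IH. Qed.

Lemma take_branch l k : (l <= k)%N -> take l (sg k) = sg l.
Proof.
elim: k => [|k IH]; first by rewrite leqn0 => /eqP->; rewrite sg0.
rewrite leq_eqVlt => /predU1P[->|lk]; first by rewrite take_oversize// size_branch.
by rewrite sgS -cats1 takel_cat ?size_branch// IH.
Qed.

(** The value that [f r] would take on the [i]-th sibling difference in an exactly biorthogonal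
    system. *)
Definition node_diff (r : seq nat) i : R :=
  (r == sg i.+1)%:R - (r == rcons (sg i) (j' i))%:R.

Lemma node_diff_sum n (c : nat -> R) r l : size r = l.+1 -> (l < n)%N ->
  \sum_(i < n) c i * node_diff r i = c l * node_diff r l.
Proof.
move=> rl ln; rewrite (bigD1 (Ordinal ln))//= big1 ?addr0// => i il.
have ri t : size t = i.+1 -> (r == t) = false.
  move=> ti; apply/eqP => rt; move/eqP: il; apply; apply/val_inj => /=.
  by apply/eqP; rewrite -eqSS -ti -rt rl.
by rewrite /node_diff !ri ?size_rcons ?size_branch// subr0 mulr0.
Qed.

Lemma node_diff_branch n l : (l < n)%N -> node_diff (take l.+1 (sg n)) l = 1.
Proof.
move=> ln; rewrite take_branch// /node_diff eqxx sgS eqseq_rcons.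
by rewrite (negPf (jj' l)) andbF subr0.
Qed.

(** While [s] follows the branch the partial sums alternate between 0 and 1. Where [s] leaves it, at
    most one further term of absolute value 1 appears, and all later terms vanish. *)
Lemma alternating_node_diff s :
  `|\sum_(l < size s) (-1) ^+ l * node_diff (take l.+1 s) l| <= 2.
Proof.
pose H r := \sum_(l < r) (-1) ^+ l * node_diff (take l.+1 s) l.
suff HP r : (r <= size s)%N ->
    if take r s == sg r then H r = (odd r)%:R else `|H r| <= 2.
  have := HP (size s) (leqnn _); case: ifP => // _; rewrite -/(H _) => ->.
  by case: odd; rewrite ?normr1 ?normr0// ler1n.
elim: r => [|r IH] rs; first by rewrite take0 sg0 eqxx /H big_ord0.
have := IH (ltnW rs); rewrite /H big_ord_recr/= -/(H r) /node_diff.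
rewrite (take_nth 0%N rs) sgS !eqseq_rcons; case: eqP => _ /=; last first.
  by rewrite subr0 mulr0 addr0.
rewrite -signr_odd => ->; have [->|_] := eqVneq (nth 0%N s r) (j r).
  by rewrite (negPf (jj' r)); case: odd => /=; lra.
by rewrite ler_norml; case: eqP => _; case: odd => /=; apply/andP; split; lra.
Qed.

Context (X : normedModType R) (e : seq nat -> X) (f : seq nat -> {scalar X}) (d : R).
Hypotheses (d0 : 0 <= d) (fe1 : forall r, f r (e r) = 1).
Hypothesis fed : forall r r', r != r' -> `|f r (e r')| <= d.

Definition sibling_diff i := e (sg i.+1) - e (rcons (sg i) (j' i)).

(** Each of the at most [n * n] pairs of a level and an index departs from exact biorthogonality by
    at most [d + d]. *)
Lemma branch_sum_sibling_diff n (c : nat -> R) s :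
  (forall i, `|c i| <= 1) -> (size s <= n)%N ->
  `|branch_sum f s (\sum_(i < n) c i *: sibling_diff i) -
    \sum_(l < size s) c l * node_diff (take l.+1 s) l| <= n%:R * (n%:R * (d + d)).
Proof.
move=> c1 sn.
have fe r r' : `|f r (e r') - (r == r')%:R| <= d.
  by case: eqP => [<-|/eqP/fed]; rewrite ?fe1 ?subrr ?normr0 ?subr0.
have -> : branch_sum f s (\sum_(i < n) c i *: sibling_diff i) -
    \sum_(l < size s) c l * node_diff (take l.+1 s) l =
    \sum_(l < size s) \sum_(i < n) c i *
      (f (take l.+1 s) (sibling_diff i) - node_diff (take l.+1 s) i).
  rewrite -sumrB; apply: eq_bigr => l _; rewrite linear_sum/=.
  rewrite -(@node_diff_sum n) ?(leq_trans _ sn)//; last first.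
    exact: size_takel (ltn_ord l).
  by rewrite -sumrB; apply: eq_bigr => i _; rewrite scalarZ [RHS]mulrBr.
have dd0 : 0 <= n%:R * (d + d) by rewrite mulr_ge0 ?addr_ge0.
apply: le_trans (ler_norm_sum _ _ _) _.
apply: (@le_trans _ _ (\sum_(l < size s) n%:R * (d + d))); last first.
  by rewrite sumr_const card_ord -[leLHS]mulr_natl ler_wpM2r ?ler_nat.
apply: ler_sum => l _; apply: le_trans (ler_norm_sum _ _ _) _.
apply: (@le_trans _ _ (\sum_(i < n) (d + d))); last first.
  by rewrite sumr_const card_ord -[leLHS]mulr_natl.
apply: ler_sum => i _; rewrite normrM -[leRHS]mul1r ler_pM//.
rewrite /sibling_diff /node_diff linearB /= opprB addrCA addrA -[X in `|X|]addrA.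
set r := take _ _; have := fe r (sg i.+1); have := fe r (rcons (sg i) (j' i)).
by move=> /ler_normlP[? ?] /ler_normlP[? ?]; rewrite ler_norml; apply/andP; split; lra.
Qed.
End Branch.

(** * Blocks along a branch *)

Section Blocks.
Context (R : realType) (X : normedModType R) (A : approximation X).

Lemma approx_finite_upto (M : nat) :
  exists (F : finType) (g : F -> {scalar X}), (forall i, dual_ball (g i)) /\
    forall m phi, (m <= M)%N -> dual_ball phi -> exists i, A m phi = g i.
Proof.
elim: M => [|M [F [g [bg Ag]]]].
  have [F [g [bg Ag]]] := approx_finite A 0; exists F, g; split=> // m phi.
  by rewrite leqn0 => /eqP->; exact: Ag.
have [F' [g' [bg' Ag']]] := approx_finite A M.+1.
exists (F + F')%type, (fun i => match i with inl i => g i | inr i => g' i end).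
split=> [[i|i]//|m phi].
rewrite leq_eqVlt => /predU1P[-> bphi|mM bphi].
  by have [i ->] := Ag' phi bphi; exists (inr i).
by have [i ->] := Ag m phi mM bphi; exists (inl i).
Qed.

(** Up to stage [M] only finitely many functionals occur, so pigeonhole yields two terms on which
    all of them nearly agree. Convergence at the single vector [y j - y j'] then supplies [M']. *)
Lemma bounded_seq_block (y : nat -> X) (B : R) (M : nat) (e : R) :
  0 < e -> (forall j, `|y j| <= B) ->
  exists j j' M', [/\ j != j', (M <= M')%N,
    forall phi m, dual_ball phi -> (m <= M)%N -> `|A m phi (y j - y j')| <= e &
    forall phi m, dual_ball phi -> (M' <= m)%N ->
      `|A m phi (y j - y j') - phi (y j - y j')| <= e].
Proof.
move=> e0 yB; have [F [g [bg Ag]]] := approx_finite_upto M.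
have [|j [j' [/andP[_ jj'] near]]] :=
  @bounded_seq_near_pair R F (fun j i => g i (y j)) B e 0 e0.
  by move=> j i; exact: le_trans (bg i (y j)) (yB j).
have [M' AM'] := approx_cvg A (y j - y j') e0.
exists j, j', (maxn M M'); split.
- by rewrite ltn_eqF.
- exact: leq_maxl.
- by move=> phi m bphi mM; have [i ->] := Ag m phi mM bphi; rewrite linearB near.
- by move=> phi m bphi; rewrite geq_max => /andP[_ mM']; exact: AM'.
Qed.

Lemma bounded_tree_branch (y : seq nat -> X) (B e : R) :
  0 < e -> (forall s, `|y s| <= B) ->
  exists (sg : nat -> seq nat) (j j' : nat -> nat) (ms : nat -> nat),
    [/\ sg 0%N = [::], forall k, sg k.+1 = rcons (sg k) (j k),
        forall k, j k != j' k & {homo ms : i j / (i <= j)%N}] /\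
    forall k, let w := y (sg k.+1) - y (rcons (sg k) (j' k)) in
      (forall phi m, dual_ball phi -> (m <= ms k)%N -> `|A m phi w| <= e) /\
      (forall phi m, dual_ball phi -> (ms k.+1 <= m)%N ->
         `|A m phi w - phi w| <= e).
Proof.
move=> e0 yB.
have /choice[next nextP] (st : seq nat * nat) : exists jjm : nat * nat * nat,
    let w := y (rcons st.1 jjm.1.1) - y (rcons st.1 jjm.1.2) in
    [/\ jjm.1.1 != jjm.1.2, (st.2 <= jjm.2)%N,
      forall phi m, dual_ball phi -> (m <= st.2)%N -> `|A m phi w| <= e &
      forall phi m, dual_ball phi -> (jjm.2 <= m)%N -> `|A m phi w - phi w| <= e].
  have [j [j' [M' H]]] := bounded_seq_block st.2 e0 (fun j => yB (rcons st.1 j)).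
  by exists (j, j', M').
pose st k := iter k (fun s => (rcons s.1 (next s).1.1, (next s).2)) ([::], 0%N).
exists (fun k => (st k).1), (fun k => (next (st k)).1.1), (fun k => (next (st k)).1.2),
  (fun k => (st k).2); split; [split=> //|].
- by move=> k; have [] := nextP (st k).
- by apply: homo_leq => [k|k l m|k]; [exact: leqnn|exact: leq_trans|have [] := nextP (st k)].
- by move=> k; have [] := nextP (st k).
Qed.
End Blocks.

(** * Two incomparable norms and the conclusion *)

(* The branch norm [N1] distinguishes the sum of the sibling differences along a
   branch (norm about [n]) from their alternating sum (norm at most 4), whereas
   the variation norm [N2] does not distinguish the images of these two vectors
   under a bounded operator, for a branch adapted to that operator. *)
Lemma incomparable_equivalent_norms (R : realType) (X : normedModType R) (K : R) :
  separable X -> ~ finite_dimensional X ->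
  exists N1 N2 : equivalent_norm X, forall S : {linear X -> X},
    ~ forall x, N1 x <= N2 (S x) /\ N2 (S x) <= K * N1 x.
Proof.
move=> /separable_approximation[A] infX.
(* The final estimate is [n - 1 <= N1 x <= 2 * N2 (S x') + 1 <= 8 * |K| + 1], which this choice
   contradicts. *)
pose n := (Num.truncn (`|K| * 8 + 2)).+1.
have nK : `|K| * 8 + 2 < n%:R by exact: truncnS_gt.
have n0 : 0 < n%:R :> R by rewrite ltr0n.
(* [d] makes the error bound of [branch_sum_sibling_diff] equal to 1; [eta] below does the same for
   [variation_norm_signed]. *)
pose d : R := (n%:R * n%:R * 2)^-1.
have d0 : 0 < d by rewrite invr_gt0 !mulr_gt0.
have dE : n%:R * (n%:R * (d + d)) = 1 :> R.
  by rewrite /d; field; rewrite lt0r_neq0.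
have [e' [f' [e1' f2' fe1' fed']]] := almost_biorthogonal infX d0.
pose e (s : seq nat) := e' (pickle s); pose f (s : seq nat) := f' (pickle s).
have fe1 s : f s (e s) = 1 by exact: fe1'.
have fed r s : r != s -> `|f r (e s)| <= d.
  by move=> rs; apply: fed'; apply: contra rs => /eqP/(pcan_inj pickleK)->.
pose eps : R := (n%:R * 2)^-1.
have eps0 : 0 < eps by rewrite invr_gt0 mulr_gt0.
have [N1 [N1ge N1le]] := @exists_branch_norm R X n eps f eps0 (fun s => f2' _).
have [N2 N2P] := @exists_variation_norm R X A n.+1 isT.
exists N1, N2 => S NS.
have N1_ge0 x : 0 <= N1 x.
  by apply: le_trans (enorm_ge N1 x); rewrite mulr_ge0// ltW// elow_gt0.
have NSK x : N2 (S x) <= `|K| * N1 x.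
  by apply: le_trans (NS x).2 _; rewrite ler_wpM2r// ler_norm.
pose eta : R := (n.*2.+1%:R * (n%:R * 4))^-1.
have m0 : 0 < n.*2.+1%:R :> R by rewrite ltr0n.
have eta0 : 0 < eta by rewrite invr_gt0 !mulr_gt0.
have etaE : n.*2.+1%:R * (n%:R * (eta *+ 4)) = 1.
  by rewrite /eta -[_ *+ 4]mulr_natr; field; rewrite !lt0r_neq0.
have SeB s : `|S (e s)| <= (elow N2)^-1 * (`|K| * eup N1).
  rewrite ler_pdivlMl ?elow_gt0//; apply: le_trans (enorm_ge N2 _) _.
  apply: le_trans (NSK _) _; rewrite ler_wpM2l//.
  by apply: le_trans (enorm_le N1 _) _; rewrite e1' mulr1.
have [sg [j [j' [ms [[sg0 sgS jj' ms_homo] wP]]]]] := bounded_tree_branch A eta0 SeB.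
pose u := sibling_diff sg j' e.
pose x := \sum_(i < n) u i; pose x' := \sum_(i < n) (-1) ^+ i *: u i.
have c1 i : `|(-1) ^+ i| = 1 :> R by rewrite normrX normrN1 expr1n.
have c1le i : `|(-1) ^+ i| <= 1 :> R by rewrite c1.
have bsd (c : nat -> R) s : (forall i, `|c i| <= 1) -> (size s <= n)%N ->
    `|branch_sum f s (\sum_(i < n) c i *: u i) -
      \sum_(l < size s) c l * node_diff R sg j' (take l.+1 s) l| <= 1.
  by move=> cle sn; rewrite -[leRHS]dE (branch_sum_sibling_diff j' sg0 sgS (ltW d0)).
have N1x : n%:R - 1 <= N1 x.
  apply: le_trans (N1ge (sg n) _ _); last by rewrite (size_branch sg0 sgS).
  have := bsd (fun=> 1) (sg n); rewrite (size_branch sg0 sgS) normr1.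
  move=> /(_ (fun=> lexx _) (leqnn _)).
  under eq_bigr do rewrite scale1r.
  under [X in _ - X]eq_bigr => l _ do rewrite (node_diff_branch R sg0 sgS jj')// mul1r.
  rewrite sumr_const card_ord -/x distrC => /(le_trans (lerB_dist _ _)).
  by rewrite ger0_norm ?ler0n// lerBlDr addrC -lerBlDr.
have N1x' : N1 x' <= 4.
  have u2 i : `|u i| <= 2.
    by apply: le_trans (ler_normB _ _) _; rewrite /e !e1'.
  have x'n : `|x'| <= n%:R * 2.
    apply: le_trans (ler_norm_sum _ _ _) _.
    apply: (@le_trans _ _ (\sum_(i < n) 2)).
      by apply: ler_sum => i _; rewrite normrZ c1 mul1r.
    by rewrite sumr_const card_ord -[leLHS]mulr_natl.
  (* The bound 4 consists of 1 from the [eps] term, 1 from the lack of exact biorthogonality and 2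
     from the alternating sum. *)
  apply: (@le_trans _ _ (eps * `|x'| + 3)); last first.
    have : eps * `|x'| <= 1 by rewrite ler_pdivrMl ?mulr_gt0// mulr1.
    lra.
  apply: N1le => s sn.
  have := bsd (fun i => (-1) ^+ i) s c1le sn.
  have := alternating_node_diff R sg0 sgS jj' s.
  set b := branch_sum _ _ _; set a := \sum_(l < size s) _ => a2 ba.
  have := ler_normD (b - a) a; rewrite subrK; lra.
have := variation_norm_signed (w := fun i : 'I_n => S (u i))
  (c := fun i : 'I_n => (-1) ^+ i) (ms := ms) N2P (ltW eta0) (fun i => c1 i) ms_homo.
rewrite etaE.
have -> : \sum_(i < n) S (u i) = S x by rewrite linear_sum.
have -> : \sum_(i < n) (-1) ^+ i *: S (u i) = S x'.
  by rewrite linear_sum/=; apply: eq_bigr => i _; rewrite linearZ.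
move=> N2S.
have {}N2S : N2 (S x) <= N2 (S x') *+ 2 + 1.
  apply: N2S => i phi m bphi mi; rewrite /u /sibling_diff linearB.
    by have [+ _] := wP i; exact.
  by have [_ +] := wP i; exact.
have := (NS x).1; have := NSK x'.
have := ler_wpM2l (normr_ge0 K) N1x'; rewrite mulr2n in N2S; lra.
Qed.

Theorem theorem1p1 (R : realType) (X : completeNormedModType R) :
  separable X ->
  (exists K : R, forall Z : completeNormedModType R,
      isomorphic Z X -> K_elastic K Z) ->
  finite_dimensional X.
Proof.
move=> sepX [K elasticK]; apply: contrapT => infX.
have [N1 [N2 NP]] := incomparable_equivalent_norms K sepX infX.
have up_gt0 (N : equivalent_norm X) : 0 < `|eup N| + 1 by rewrite ltr_wpDl.
have lo (N : equivalent_norm X) (x : X) : (`|eup N| + 1)^-1 * N x <= `|x|.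
  rewrite ler_pdivrMl//; apply: le_trans (enorm_le N x) _; rewrite ler_wpM2r//.
  by apply: le_trans (ler_norm _) _; rewrite lerDl.
have hi (N : equivalent_norm X) (x : X) : `|x| <= (elow N)^-1 * N x.
  by rewrite ler_pdivlMl ?elow_gt0// enorm_ge.
have isoN (N : equivalent_norm X) : isomorphic (renormed N) X.
  exists (fun x : renormed N => x : X), (`|eup N| + 1)^-1, (elow N)^-1.
  split; first by [].
  split; first by rewrite invr_gt0.
  split; first by move=> x _; exists x.
  by move=> x; split; [exact: lo|exact: hi].
(* The identity embeds [renormed N1] isomorphically into [renormed N2], so elasticity supplies a
   [K]-embedding [T] between them. *)
have [] := elasticK (renormed N2) (isoN N2) (renormed N1).
  exists (fun x : renormed N1 => x : renormed N2),
    (elow N2 * (`|eup N1| + 1)^-1), ((`|eup N2| + 1) * (elow N1)^-1).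
  split; first by [].
  split; first by rewrite mulr_gt0 ?elow_gt0 ?invr_gt0.
  move=> x; split; rewrite -mulrA.
    apply: le_trans (enorm_ge N2 x); rewrite ler_wpM2l ?(ltW (elow_gt0 N2))//.
    exact: lo.
  rewrite -ler_pdivrMl//; apply: le_trans (lo N2 x) _; exact: hi.
move=> T [Tlin TK].
pose S : {linear X -> X} := HB.pack_for {linear X -> X} (T : X -> X)
  (GRing.isLinear.Build R X X *:%R (T : X -> X) Tlin).
by apply: (NP S) => x; exact: TK.
Qed.
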